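(* Let $r\in(0,1/2)$. Consider the independent-coding distributed delay diversity scheme described in the context, with deterministic delays whose relative delay $T_0=|\tau_2-\tau_1|$ satisfies $T_0B_w\ge2$. Then $$d_{TDA}(r):=\lim_{\mathrm{SNR}\to\infty}-\frac{\log\Pr[I_{TDA}<R(\mathrm{SNR})]}{\log\mathrm{SNR}}=3(1-2r).$$ This equals the diversity–multiplexing tradeoff $d_{stc}(r)$ of the synchronous space-time-coded scheme.
   Context: Network: a source $N_S$, two relays $N_{R_1},N_{R_2}$ and a destination $N_D$. The gains $\alpha_{i,j}$, $i\in\{S,R_1,R_2\}$, $j\in\{R_1,R_2,D\}$, $i\neq j$, are mutually independent zero-mean circularly symmetric complex Gaussian random variables with variances $\sigma^2_{i,j}>0$. For $\mathrm{SNR}>0$ set $\rho_0=\frac23\mathrm{SNR}$. The target rate is $R=R(\mathrm{SNR})=r\log(1+\mathrm{SNR}\,\sigma^2_{S,D})$. Relay $R_k$ belongs to the decoding set $\mathcal D(s)$ iff $\frac12\log(1+\rho_0|\alpha_{S,R_k}|^2)\ge R$. Independent-coding distributed delay diversity scheme: - Signals have baseband bandwidth $B_w>0$. - In phase 2 all successful relays send the same Gaussian codeword, independent of the source codeword. - The signal from relay $R_k$ reaches $N_D$ with delay $\tau_k$. - Conditioned on $\mathcal D(s)$, $$I_{TDA}=\frac12\log(1+\rho_0|\alpha_{S,D}|^2)+\frac{1}{2B_w}\int_{-B_w/2}^{B_w/2}\log\left(1+\rho_0\Big|\sum_{R_k\in\mathcal D(s)}\alpha_{R_k,D}e^{j2\pi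 f\tau_k}\Big|^2\right)df,$$ where an empty sum equals $0$. The probability $\Pr[I_{TDA}<R]$ averages over the gains, including the randomness of $\mathcal D(s)$. *)

(* Defs.v *)
From mathcomp Require Import all_boot all_order all_algebra.
From mathcomp Require Import all_classical all_reals all_analysis.
Set Implicit Arguments. Unset Strict Implicit. Unset Printing Implicit Defensive.
Import Order.TTheory GRing.Theory Num.Theory.
Import numFieldNormedType.Exports.
Local Open Scope classical_set_scope.
Local Open Scope ring_scope.

Section Model.
Variable R : realType.

(* complex numbers written as pairs (real part, imaginary part) *)
Definition csqnorm (z : R * R) : R := z.1 ^+ 2 + z.2 ^+ 2.

(* density on R^2 ~ C of a zero-mean circularly symmetric complex Gaussian
   with variance s2 = E|z|^2 :  (1/(pi s2)) exp(-|z|^2/s2) *)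
Definition cgauss_pdf (s2 : R) (z : R * R) : R :=
  (pi * s2)^-1 * expR (- csqnorm z / s2).

Definition rho0 (snr : R) : R := 2 / 3 * snr.

Definition rate (r s2SD snr : R) : R := r * ln (1 + snr * s2SD).

Definition decodes (r s2SD snr : R) (aSR : R * R) : bool :=
  rate r s2SD snr <= 2^-1 * ln (1 + rho0 snr * csqnorm aSR).

(* alpha * e^{j 2 pi f tau}, as a pair *)
Definition crot (a : R * R) (f tau : R) : R * R :=
  let t := 2 * pi * f * tau in
  (a.1 * cos t - a.2 * sin t, a.1 * sin t + a.2 * cos t).

Definition cadd (a b : R * R) : R * R := (a.1 + b.1, a.2 + b.2).

(* sum over the decoding set of alpha_{R_k,D} e^{j 2 pi f tau_k} (empty sum = 0) *)
Definition relay_sum (d1 d2 : bool) (aR1D aR2D : R * R) (tau1 tau2 f : R)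
  : R * R :=
  cadd (if d1 then crot aR1D f tau1 else (0, 0))
       (if d2 then crot aR2D f tau2 else (0, 0)).

Definition I_TDA (r s2SD snr Bw tau1 tau2 : R)
  (aSR1 aSR2 aSD aR1D aR2D : R * R) : R :=
  let d1 := decodes r s2SD snr aSR1 in
  let d2 := decodes r s2SD snr aSR2 in
  2^-1 * ln (1 + rho0 snr * csqnorm aSD)
  + (2 * Bw)^-1 *
    Rintegral (@lebesgue_measure R) `[- (Bw / 2), Bw / 2]%classic
      (fun f => ln (1 + rho0 snr
                        * csqnorm (relay_sum d1 d2 aR1D aR2D tau1 tau2 f))).

(* Pr[I_TDA < R(SNR)]: integral over the joint (product) Gaussian density of
   the independent gains alpha_{S,R1}, alpha_{S,R2}, alpha_{S,D},
   alpha_{R1,D}, alpha_{R2,D}, each viewed in R^2. *)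
Definition outage_prob (r Bw tau1 tau2 s2SR1 s2SR2 s2SD s2R1D s2R2D snr : R)
  : R :=
  fine (\int[@lebesgue_measure R]_x1 \int[@lebesgue_measure R]_y1
        \int[@lebesgue_measure R]_x2 \int[@lebesgue_measure R]_y2
        \int[@lebesgue_measure R]_x3 \int[@lebesgue_measure R]_y3
        \int[@lebesgue_measure R]_x4 \int[@lebesgue_measure R]_y4
        \int[@lebesgue_measure R]_x5 \int[@lebesgue_measure R]_y5
        ((if I_TDA r s2SD snr Bw tau1 tau2 (x1, y1) (x2, y2) (x3, y3)
                   (x4, y4) (x5, y5) < rate r s2SD snr
          then 1 else 0)
         * cgauss_pdf s2SR1 (x1, y1) * cgauss_pdf s2SR2 (x2, y2)
         * cgauss_pdf s2SD (x3, y3) * cgauss_pdf s2R1D (x4, y4)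
         * cgauss_pdf s2R2D (x5, y5))%:E)%E.

End Model.

(* Main.v *)
Require Import Defs.
From mathcomp Require Import all_boot all_order all_algebra.
From mathcomp Require Import all_classical all_reals all_analysis.
From mathcomp Require Import measurable_realfun.
From mathcomp Require Import ring lra.
Import Order.TTheory GRing.Theory Num.Theory.
Import numFieldNormedType.Exports.
Local Open Scope classical_set_scope.
Local Open Scope ring_scope.

(* Write N = exp(2R) ~ SNR^(2r). The outage event is squeezed between events on
   which three independent squared gains are below N/SNR, up to constants and
   arbitrarily small powers of SNR; such an event has probability of order
   (N/SNR)^3 = SNR^(-3(1-2r)).

   Lower bound on the outage probability: if |a_SD|^2, |a_SR1|^2 and |a_SR2|^2
   are all below a multiple of N/SNR, no relay decodes and the direct link fails.

   Upper bound: outage forces |a_SD|^2 to be small, and a relay that does not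
   decode has a small |a_SRk|^2; it remains to see that for a relay that decodes
   |a_RkD|^2 is small. With distinct delays the received power
   |a_1 e^(i w f tau_1) + a_2 e^(i w f tau_2)|^2 is below delta |a_k|^2 only on a
   set of frequencies of proportion eta(delta) -> 0, uniformly in the gains, so
   the relay term is at least (1 - eta)/2 log(1 + rho0 delta |a_k|^2). *)

(* Unlike [ge0_le_integral], this needs no measurability: the integral of a
   nonnegative function is a supremum over the simple functions below it. *)
Lemma ge0_le_integral_sup d (T : measurableType d) (R : realType)
    (mu : {measure set T -> \bar R}) (D : set T) (f g : T -> \bar R) :
  (forall x, D x -> 0 <= f x)%E -> (forall x, D x -> f x <= g x)%E ->
  (\int[mu]_(x in D) f x <= \int[mu]_(x in D) g x)%E.
Proof.
move=> f0 fg; rewrite !ge0_integralE//; last first.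
  by move=> x Dx; apply: le_trans (fg _ Dx); exact: f0.
apply: le_ereal_sup => _ [h /= hf <-]; exists h => //= x.
apply: (le_trans (hf x)); rewrite !patchE.
by case: ifPn => // /[!inE] /fg.
Qed.

Section DelayDiversity.
Context {R : realType}.
Implicit Types (a b : R * R) (f g tau t : R).

Local Notation mu := (@lebesgue_measure R).

(** * Received relay power as a function of frequency *)

Lemma csqnorm_ge0 a : 0 <= csqnorm a.
Proof. by rewrite addr_ge0 ?sqr_ge0. Qed.

(** A silent relay contributes the same as one with zero gain, so a single bound for two active
    relays covers all four decoding sets. *)
Lemma relay_sum_if d1 d2 a b tau1 tau2 f :
  relay_sum d1 d2 a b tau1 tau2 f =
  relay_sum true true (if d1 then a else 0) (if d2 then b else 0) tau1 tau2 f.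
Proof.
have crot0 tau : crot (0 : R * R) f tau = 0.
  by rewrite /crot/= !mul0r subr0 addr0.
by rewrite /relay_sum; case: d1; case: d2; rewrite ?crot0.
Qed.

Lemma csqnorm_relay_sumC a b tau1 tau2 f :
  csqnorm (relay_sum true true a b tau1 tau2 f) =
  csqnorm (relay_sum true true b a tau2 tau1 f).
Proof. by rewrite /relay_sum /cadd /csqnorm /= ![_ + (b.1 * _ - _)]addrC
  ![_ + (b.1 * _ + _)]addrC. Qed.

(** Multiplying the sum by the unit phase that cancels the first delay keeps its modulus, so only
    the relative delay remains. *)
Lemma csqnorm_relay_sumE a b tau1 tau2 f (t := 2 * pi * f * (tau2 - tau1)) :
  csqnorm (relay_sum true true a b tau1 tau2 f) =
  (a.1 + (b.1 * cos t - b.2 * sin t)) ^+ 2 +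
  (a.2 + (b.1 * sin t + b.2 * cos t)) ^+ 2.
Proof.
rewrite /t mulrBr cosB sinB /csqnorm /relay_sum /cadd /crot /=.
have := cos2Dsin2 (2 * pi * f * tau1); have := cos2Dsin2 (2 * pi * f * tau2).
move: (cos _) (sin _) (cos _) (sin _) => c2 s2 c1 s1 E1 E2.
have {}E1 : s1 ^+ 2 = 1 - c1 ^+ 2 by rewrite -E1; ring.
have {}E2 : s2 ^+ 2 = 1 - c2 ^+ 2 by rewrite -E2; ring.
ring: E1 E2.
Qed.

(* Since |z|^2 + |w|^2 >= |z - w|^2 / 2, the received power cannot be small at
   two frequencies where the relative phases of the two relays differ. *)
Lemma relay_power_pair a b tau1 tau2 f g :
  csqnorm b * (1 - cos (2 * pi * (tau2 - tau1) * (f - g))) <=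
  csqnorm (relay_sum true true a b tau1 tau2 f) +
  csqnorm (relay_sum true true a b tau1 tau2 g).
Proof.
rewrite !csqnorm_relay_sumE /csqnorm.
have -> : 2 * pi * (tau2 - tau1) * (f - g) =
  2 * pi * f * (tau2 - tau1) - 2 * pi * g * (tau2 - tau1) by ring.
rewrite cosB.
have := cos2Dsin2 (2 * pi * g * (tau2 - tau1)).
have := cos2Dsin2 (2 * pi * f * (tau2 - tau1)).
move: (cos _) (sin _) (cos _) (sin _) => c2 s2 c1 s1 E1 E2.
set u1 := b.1 * c1 - b.2 * s1; set u2 := b.1 * s1 + b.2 * c1.
set v1 := b.1 * c2 - b.2 * s2; set v2 := b.1 * s2 + b.2 * c2.
(* [u] and [v] are [b] rotated by the two phases; two rotations of [b] differ by a vector of squared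
   length [2 |b|^2 (1 - cos)] of the phase difference. *)
have -> : (b.1 ^+ 2 + b.2 ^+ 2) * (1 - (c1 * c2 + s1 * s2)) =
   2^-1 * ((u1 - v1) ^+ 2 + (u2 - v2) ^+ 2).
  have {}E1 : s1 ^+ 2 = 1 - c1 ^+ 2 by rewrite -E1; ring.
  have {}E2 : s2 ^+ 2 = 1 - c2 ^+ 2 by rewrite -E2; ring.
  by rewrite /u1 /u2 /v1 /v2; field: E1 E2.
(* The difference of the two sides is half the square of [2 * x + u + v]. *)
have h (x u v : R) : 2^-1 * (u - v) ^+ 2 <= (x + u) ^+ 2 + (x + v) ^+ 2.
  have := sqr_ge0 (2 * x + u + v); nra.
have := h a.1 u1 v1; have := h a.2 u2 v2; lra.
Qed.


Lemma continuous_relay_power a b tau1 tau2 :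
  continuous (fun f => csqnorm (relay_sum true true a b tau1 tau2 f)).
Proof.
pose lin (x y : R) tau f := x * cos (2 * pi * f * tau) + y * sin (2 * pi * f * tau).
have clin x y tau : continuous (lin x y tau).
  move=> f; have cphase : {for f, continuous (fun f => 2 * pi * f * tau)}.
    by apply: cvgM; [apply: cvgM; [exact: cvg_cst|exact: cvg_id]|exact: cvg_cst].
  apply: cvgD; apply: cvgM; try exact: cvg_cst.
    exact: (continuous_comp cphase (@continuous_cos _ _)).
  exact: (continuous_comp cphase (@continuous_sin _ _)).
have -> : (fun f => csqnorm (relay_sum true true a b tau1 tau2 f)) =
  (fun f => (lin a.1 (- a.2) tau1 f + lin b.1 (- b.2) tau2 f) *
            (lin a.1 (- a.2) tau1 f + lin b.1 (- b.2) tau2 f) +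
            (lin a.2 a.1 tau1 f + lin b.2 b.1 tau2 f) *
            (lin a.2 a.1 tau1 f + lin b.2 b.1 tau2 f)).
  by apply/funext => f; rewrite /csqnorm /relay_sum /cadd /crot /lin/=; ring.
by move=> f; apply: cvgD; apply: cvgM; apply: cvgD; exact: clin.
Qed.

(** * Measure of the bad frequencies and the relay integral *)

(** Cut the interval into [n] cells of length [h]. Within a cell all points of [A] lie within [d] of
    any one of them, hence in an interval of length [2 * d]; then sum over the cells. *)
Lemma lebesgue_measure_small_diameter (A : set R) (c h d : R) (n : nat) :
  measurable A -> 0 <= d ->
  (forall f g, A f -> A g -> `|f - g| <= h -> `|f - g| <= d) ->
  (mu (A `&` `[c, (c + n%:R * h)%R]) <= (n%:R * (2 * d))%:E)%E.
Proof.
move=> mA d0 diamA; have mAI (x y : R) : measurable (A `&` `[x, y]).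
  exact: measurableI.
have one x : (mu (A `&` `[x, (x + h)%R]) <= (2 * d)%:E)%E.
  have [/set0P[f [Af /=]]|/negPn/eqP ->] :=
      boolP (A `&` `[x, (x + h)%R] != set0); last first.
    by rewrite measure0 lee_fin mulr_ge0.
  rewrite in_itv/= => /andP[xf fx].
  apply: (@le_trans _ _ (mu `[(f - d)%R, (f + d)%R])).
    apply: le_measure; rewrite ?inE; [exact: mAI|by []|].
    move=> g [Ag /=]; rewrite in_itv/= => /andP[xg gx].
    have : `|g - f| <= d by apply: diamA => //; rewrite ler_norml; lra.
    by rewrite in_itv/= ler_norml => /andP[? ?]; apply/andP; split; lra.
  rewrite lebesgue_measure_itv/= lte_fin; case: ifPn => _; last first.
    by rewrite lee_fin mulr_ge0.
  by rewrite -EFinB lee_fin; lra.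
elim: n => [|n IH].
  rewrite !mul0r addr0 set_itv1.
  apply: (@le_trans _ _ (mu [set c])); last by rewrite lebesgue_measure_set1.
  by apply: le_measure; rewrite ?inE; [exact: measurableI|by []|move=> ? []].
apply: (@le_trans _ _ (mu ((A `&` `[c, (c + n%:R * h)%R]) `|`
    (A `&` `[(c + n%:R * h)%R, (c + n%:R * h + h)%R])))).
  apply: le_measure; rewrite ?inE; [exact: mAI|by apply: measurableU; exact: mAI|].
  move=> f [Af /=]; rewrite in_itv/= -natr1 => /andP[cf fc].
  have [fl|fg] := leP f (c + n%:R * h); [left|right]; split => //=.
    by rewrite in_itv/= cf fl.
  by rewrite in_itv/= (ltW fg) -addrA -{2}[h]mul1r -mulrDl.
have := measureU2 mu (mAI c (c + n%:R * h)) (mAI (c + n%:R * h) (c + n%:R * h + h)).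
move=> /le_trans; apply.
by rewrite -natr1 mulrDl mul1r EFinD; apply: leeD; [exact: IH|exact: one].
Qed.

(** A Markov-type bound: drop the part of the integral where [F] is below [L]; what is left has
    length at least [v - u - e]. *)
Lemma ge0_Rintegral_superlevel (F : R -> R) (u v L e : R) : u <= v ->
  continuous F -> (forall f, 0 <= F f) -> 0 <= L ->
  (mu ([set f | (F f < L)%R] `&` `[u, v]) <= e%:E)%E ->
  L * (v - u - e) <= Rintegral mu `[u, v] F.
Proof.
move=> uv cF F0 L0 bad.
have mF : measurable_fun setT F by exact: continuous_measurable_fun.
have mbad : measurable [set f | F f < L].
  have := measurable_fun_ltr mF (measurable_cst L).
  by move=> /(_ measurableT [set true] I); rewrite setTI.
have mI : measurable (`[u, v] : set R) by [].
have intF : mu.-integrable `[u, v] (EFin \o F).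
  apply: continuous_compact_integrable; first exact: segment_compact.
  exact: continuous_subspaceT.
rewrite -lee_fin /Rintegral fineK; last exact: integrable_fin_num.
set G := `[u, v] `\` [set f | F f < L].
have mG : measurable G by exact: measurableD.
apply: (@le_trans _ _ (\int[mu]_(x in G) (F x)%:E)%E); last first.
  apply: ge0_subset_integral => //; last by move=> x [].
  - by apply: measurable_funTS; exact: measurableT_comp.
  - by move=> x _; rewrite lee_fin.
apply: (@le_trans _ _ (\int[mu]_(x in G) (cst L%:E) x)%E).
  rewrite integral_cst// EFinM; apply: lee_wpmul2l; first by rewrite lee_fin.
  have muI : mu `[u, v] = (v - u)%:E.
    rewrite lebesgue_measure_itv/= lte_fin; case: ltP => [_|vu]; first by [].
    by have -> : v = u by [apply/eqP; rewrite eq_le vu uv]; rewrite subrr.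
  rewrite /G measureD//= ?muI ?ltry// EFinB leeB// setIC.
  exact: bad.
apply: ge0_le_integral_sup => [x _|x [_ /negP]]; first by rewrite lee_fin.
by rewrite -leNgt lee_fin.
Qed.

(** By [relay_power_pair], two frequencies of low power at distance at most [h] must be within [d]
    of each other. The low-power set therefore occupies at most a fraction [eta] of the band, and
    [delta] depends on neither the gains nor [rho]. *)
Lemma Rintegral_relay_power_lower (Bw tau1 tau2 eta : R) :
  0 < Bw -> tau1 != tau2 -> 0 < eta -> eta < 1 ->
  exists2 delta : R, 0 < delta <= 1 & forall (rho : R) a b, 0 <= rho ->
    let J := Rintegral mu `[- (Bw / 2), Bw / 2] (fun f =>
      ln (1 + rho * csqnorm (relay_sum true true a b tau1 tau2 f))) in
    Bw * (1 - eta) * ln (1 + rho * delta * csqnorm a) <= J /\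
    Bw * (1 - eta) * ln (1 + rho * delta * csqnorm b) <= J.
Proof.
move=> Bw0 tau12 eta0 eta1.
pose T : R := `|tau2 - tau1|.
have T0 : 0 < T by rewrite normr_gt0 subr_eq0 eq_sym.
(* With this many cells the relative phase varies by at most [pi] over a cell, where the cosine is
   decreasing; [d] is then fixed by [n * (2 * d) = eta * Bw]. *)
pose n := (Num.truncn (2 * T * Bw)).+1.
have n0 : (0 : R) < n%:R by rewrite ltr0n.
pose h : R := Bw / n%:R; pose d : R := eta * Bw / (2 * n%:R).
have nhB : n%:R * h = Bw by rewrite /h; field; rewrite gt_eqF.
have Th : 2 * T * h <= 1.
  rewrite /h mulrA ler_pdivrMr// mul1r ltW// /n.
  by rewrite truncnS_gt.
have h0 : 0 < h by rewrite divr_gt0.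
have dE : d = eta / 2 * h by rewrite /d/h; field; rewrite gt_eqF.
have d0 : 0 < d by rewrite dE mulr_gt0// divr_gt0.
have nd : n%:R * (2 * d) = eta * Bw by rewrite dE -nhB; field.
have dh : d <= h by rewrite dE; nra.
have pi0 : 0 < pi :> R by exact: pi_gt0.
pose phi (x : R) := 2 * pi * T * x.
have phiI (x : R) : 0 <= x <= h -> phi x \in `[0, pi].
  move=> /andP[x0 xh]; rewrite in_itv/= /phi; apply/andP; split.
    by rewrite !mulr_ge0// ltW.
  have -> : 2 * pi * T * x = pi * (2 * T * x) by ring.
  rewrite ler_piMr ?(ltW pi0)// (le_trans _ Th)// ler_pM2l//; lra.
have w0 : 0 < 2 * pi * T by rewrite mulr_gt0// mulr_gt0.
(* Halved because the pair inequality bounds a sum of two powers, each assumed below [delta] times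
   the squared gain. *)
pose delta : R := (1 - cos (phi d)) / 2.
have delta0 : 0 < delta.
  have phid : phi d \in `[0, pi] by apply: phiI; rewrite (ltW d0).
  have phi0 : 0 \in `[0, (pi : R)] by rewrite in_itv/= lexx ltW.
  have : cos (phi d) < cos 0 by rewrite ltr_cos// mulr_gt0.
  by rewrite cos0 /delta; lra.
have delta1 : delta <= 1 by rewrite /delta; have := cos_geN1 (phi d); lra.
exists delta => [|rho a b rho0 J]; first by rewrite delta0.
(* The pair inequality sees only the second gain; exchanging the relays, which preserves [T], gives
   the bound for the first. *)
suff main a' b' t1 t2 : `|t2 - t1| = T ->
    Bw * (1 - eta) * ln (1 + rho * delta * csqnorm b') <=
    Rintegral mu `[- (Bw / 2), Bw / 2] (fun f =>
      ln (1 + rho * csqnorm (relay_sum true true a' b' t1 t2 f))).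
  split; last exact: main.
  rewrite /J; under eq_Rintegral do rewrite csqnorm_relay_sumC.
  by apply: main; rewrite distrC.
move=> tT; set F := fun f => _; set L := ln _.
have ge1 (x y : R) : 0 <= x -> 0 <= y -> 1 <= 1 + x * y.
  by move=> x0 y0; rewrite lerDl mulr_ge0.
have q0 := csqnorm_ge0.
have cF : continuous F.
  move=> f; pose q1 f := 1 + rho * csqnorm (relay_sum true true a' b' t1 t2 f).
  have cq1 : {for f, continuous q1}.
    apply: cvgD; [exact: cvg_cst|apply: cvgM; [exact: cvg_cst|]].
    exact: continuous_relay_power.
  by apply: (continuous_comp cq1); apply: continuous_ln;
    rewrite (lt_le_trans ltr01)// ge1.
have bad : (mu ([set f | (F f < L)%R] `&` `[(- (Bw / 2))%R, (Bw / 2)%R])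
    <= (eta * Bw)%:E)%E.
  rewrite -nd; have {2}-> : Bw / 2 = - (Bw / 2) + n%:R * h.
    by rewrite nhB; lra.
  apply: (@lebesgue_measure_small_diameter _ (- (Bw / 2)) h d n).
  - have := measurable_fun_ltr (continuous_measurable_fun cF) (measurable_cst L).
    by move=> /(_ measurableT [set true] I); rewrite setTI.
  - exact: ltW.
  (* If [d < |f - g| <= h], the two powers would add up to less than [2 * delta * csqnorm b'], while
     the pair inequality and monotonicity of the cosine force at least that much. *)
  move=> f g /= Ff Fg fgh; rewrite leNgt; apply/negP => dfg.
  have low x : F x < L ->
      csqnorm (relay_sum true true a' b' t1 t2 x) < delta * csqnorm b'.
    rewrite ltNge => /negP FL; rewrite ltNge; apply/negP => qb; apply: FL.
    rewrite /F /L ler_ln ?posrE ?(lt_le_trans ltr01)// ?ge1//; last first.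
      by rewrite mulr_ge0// ltW.
    by rewrite lerD2l -mulrA ler_wpM2l.
  have := relay_power_pair a' b' t1 t2 f g.
  have -> : cos (2 * pi * (t2 - t1) * (f - g)) = cos (phi `|f - g|).
    by rewrite -cos_norm /phi -tT !normrM (ger0_norm (ltW pi0)) ger0_norm.
  have : cos (phi `|f - g|) < cos (phi d).
    rewrite ltr_cos ?phiI ?normr_ge0 ?(ltW d0)//.
    by rewrite /phi ltr_pM2l.
  have := low _ Ff; have := low _ Fg.
  rewrite /delta; have := q0 b'. nra.
have -> : Bw * (1 - eta) * L = L * (Bw / 2 - - (Bw / 2) - eta * Bw) by field.
apply: ge0_Rintegral_superlevel => //.
- lra.
- by move=> f; rewrite ln_ge0// ge1.
- by rewrite ln_ge0// ge1// mulr_ge0// ltW.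
Qed.

(** * One-dimensional Gaussian bounds and their complex versions *)

(** Density of the real or imaginary part of a complex gain of variance [s]: a centred normal law of
    variance [s / 2]. *)
Definition gauss (s x : R) : R := (Num.sqrt (pi * s))^-1 * expR (- x ^+ 2 / s).

(** Discs in the complex plane are replaced by squares, so that integrals split into real
    coordinates: the square [x^2 < t], [y^2 < t] contains the disc of squared radius [t] and lies in
    that of squared radius [2 * t]. *)
Definition small (t : R) : R -> R := \1_(`]- Num.sqrt t, Num.sqrt t[%classic).

Lemma smallE t x : 0 < t -> small t x = (if x ^+ 2 < t then 1 else 0).
Proof.
move=> t0; rewrite /small indicE mem_setE in_itv/= -ltr_norml -sqrtr_sqr ltr_sqrt//.
by case: ifP.
Qed.

Lemma small_ge0 t x : 0 <= small t x.
Proof. by rewrite /small indicE ler0n. Qed.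

Lemma gauss_ge0 s x : 0 <= gauss s x.
Proof. by rewrite mulr_ge0 ?expR_ge0// invr_ge0 sqrtr_ge0. Qed.

Lemma cgauss_pdf_ge0 s a : 0 < s -> 0 <= cgauss_pdf s a.
Proof.
by move=> s0; rewrite mulr_ge0 ?expR_ge0// invr_ge0 mulr_ge0 ?pi_ge0// ltW.
Qed.

Lemma cgauss_pdfE s x y : 0 < s -> cgauss_pdf s (x, y) = gauss s x * gauss s y.
Proof.
move=> s0; rewrite /gauss mulrACA -invfM -expr2 sqr_sqrtr; last first.
  by rewrite mulr_ge0 ?pi_ge0// ltW.
rewrite -expRD /cgauss_pdf /csqnorm /=; congr (_ * expR _); lra.
Qed.

Lemma gaussE s x : 0 < s -> gauss s x = normal_pdf 0 (Num.sqrt (s / 2)) x.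
Proof.
move=> s0; rewrite normal_pdfE; last by rewrite gt_eqF// sqrtr_gt0 divr_gt0.
rewrite /normal_peak /normal_fun sqr_sqrtr ?divr_ge0 ?(ltW s0)// subr0 /gauss.
by congr ((Num.sqrt _)^-1 * expR (_ / _)); rewrite -mulr_natr; field.
Qed.

Lemma measurable_gauss s : 0 < s -> measurable_fun setT (gauss s).
Proof.
move=> s0; have -> : gauss s = normal_pdf 0 (Num.sqrt (s / 2)).
  by apply/funext => x; exact: gaussE.
exact: measurable_normal_pdf.
Qed.

Lemma integral_gauss s : 0 < s -> (\int[mu]_x (gauss s x)%:E)%E = 1%E.
Proof.
move=> s0; under eq_integral do rewrite gaussE//.
exact: integral_normal_pdf.
Qed.

Lemma measurable_small t : measurable_fun setT (small t).
Proof. exact: measurable_indic. Qed.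

Lemma integral_small t (c : R) : 0 <= c ->
  (\int[mu]_x (c * small t x)%:E)%E = (c * (2 * Num.sqrt t))%:E.
Proof.
move=> c0; under eq_integral do rewrite EFinM.
rewrite ge0_integralZl_EFin//; last 2 first.
- by move=> x _; rewrite lee_fin small_ge0.
- by apply/measurable_EFinP; exact: measurable_small.
rewrite integral_indic// setIT /= lebesgue_measure_itv/= lte_fin.
have t0 := sqrtr_ge0 t.
case: ifPn => [_|]; first by rewrite -EFinB -EFinM; congr (_ * _)%:E; lra.
rewrite -leNgt => tt; have -> : Num.sqrt t = 0 by lra.
by rewrite mulr0 mule0 mulr0.
Qed.

(** The [a] term uses total mass one, the [b] term the peak value of the density. Since [F] is only
    bounded pointwise, the lemma can be applied to iterated integrals from the outside in, without
    measurability of the inner ones. *)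
Lemma integral_gauss_upper s t (a b : R) (F : R -> \bar R) :
  0 < s -> 0 <= a -> 0 <= b ->
  (forall x, 0 <= F x <= ((a + b * small t x) * gauss s x)%:E)%E ->
  (0 <= \int[mu]_x F x <= (a + b * (2 * Num.sqrt t / Num.sqrt (pi * s)))%:E)%E.
Proof.
move=> s0 a0 b0 FE; have pk0 : 0 <= (Num.sqrt (pi * s))^-1 :> R.
  by rewrite invr_ge0 sqrtr_ge0.
apply/andP; split; first by apply: integral_ge0 => x _; case/andP: (FE x).
set c := b / Num.sqrt (pi * s); have c0 : 0 <= c by rewrite mulr_ge0.
apply: (@le_trans _ _ (\int[mu]_x ((a * gauss s x)%:E + (c * small t x)%:E))%E).
  apply: ge0_le_integral_sup => x _; first by case/andP: (FE x).
  case/andP: (FE x) => _ /le_trans; apply.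
  rewrite -EFinD lee_fin mulrDl lerD2l -mulrA -[c * _]mulrA ler_wpM2l// mulrC.
  rewrite ler_wpM2r ?small_ge0// ler_piMr//.
  by rewrite -expR0 ler_expR mulNr oppr_le0 divr_ge0 ?sqr_ge0// ltW.
rewrite ge0_integralD//; last 4 first.
- by move=> x _; rewrite lee_fin mulr_ge0// gauss_ge0.
- by apply/measurable_EFinP; apply: measurable_funM => //; exact: measurable_gauss.
- by move=> x _; rewrite lee_fin mulr_ge0// small_ge0.
- by apply/measurable_EFinP; apply: measurable_funM => //; exact: measurable_small.
rewrite integral_small//; under eq_integral do rewrite EFinM.
rewrite ge0_integralZl_EFin//; last 2 first.
- by move=> x _; rewrite lee_fin gauss_ge0.
- by apply/measurable_EFinP; exact: measurable_gauss.
by rewrite integral_gauss// mule1 -EFinD lee_fin /c; lra.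
Qed.

(** [P] bounds the probability of the square. It enters through an equation so that it can stay an
    opaque symbol in polynomial identities. *)
Lemma integral_cgauss_upper s t (P a b : R) (F : R -> R -> \bar R) :
  P = 4 * t / (pi * s) -> 0 < s -> 0 <= t -> 0 <= a -> 0 <= b ->
  (forall x y, 0 <= F x y <=
    ((a + b * (small t x * small t y)) * cgauss_pdf s (x, y))%:E)%E ->
  (0 <= \int[mu]_x \int[mu]_y F x y <= (a + b * P)%:E)%E.
Proof.
move=> -> s0 t0 a0 b0 FE; set q := 2 * Num.sqrt t / Num.sqrt (pi * s) : R.
have q0 : 0 <= q by rewrite /q divr_ge0// ?sqrtr_ge0// mulr_ge0// sqrtr_ge0.
have -> : a + b * (4 * t / (pi * s)) = a + b * q * q.
  rewrite -[b * q * q]mulrA -expr2 /q !exprMn exprVn !sqr_sqrtr//; last first.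
    by rewrite mulr_ge0 ?pi_ge0// ltW.
  by congr (_ + _ * (_ * _ / _)); ring.
apply: integral_gauss_upper => //; first exact: mulr_ge0.
move=> x; have g0 := gauss_ge0 s x; have k0 := small_ge0 t x.
have -> : (a + b * q * small t x) * gauss s x =
    a * gauss s x + b * small t x * gauss s x * q by ring.
apply: integral_gauss_upper => //;
  do ?apply: mulr_ge0 => //.
move=> y; have /andP[-> /le_trans] := FE x y; apply.
by rewrite lee_fin cgauss_pdfE//; lra.
Qed.

(** For [t <= 1] the exponent [x^2 / s] stays below [1 / s] on the interval, which bounds the
    density from below by a constant. *)
Lemma integral_small_gauss_lower s t (b : R) (F : R -> \bar R) :
  0 < s -> 0 < t -> t <= 1 -> 0 <= b ->
  (forall x, (b * small t x * gauss s x)%:E <= F x)%E ->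
  ((b * (expR (- s^-1) / Num.sqrt (pi * s) * (2 * Num.sqrt t)))%:E
    <= \int[mu]_x F x)%E.
Proof.
move=> s0 t0 t1 b0 FE; set c := expR (- s^-1) / Num.sqrt (pi * s) : R.
have c0 : 0 <= c by rewrite divr_ge0 ?expR_ge0// sqrtr_ge0.
rewrite mulrA -integral_small ?mulr_ge0//.
apply: ge0_le_integral_sup => x _; first by rewrite lee_fin !mulr_ge0// small_ge0.
apply: le_trans (FE x); rewrite lee_fin smallE//.
case: ifPn => [xt|_]; last by rewrite !mulr0 mul0r.
rewrite !mulr1 ler_wpM2l// /c /gauss mulrC ler_wpM2l ?invr_ge0 ?sqrtr_ge0//.
by rewrite ler_expR mulNr lerN2 ler_piMl ?invr_ge0 ?ltW// (lt_le_trans xt).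
Qed.

Lemma integral_gauss_lower s (b : R) (F : R -> \bar R) : 0 < s -> 0 <= b ->
  (forall x, (b * gauss s x)%:E <= F x)%E -> (b%:E <= \int[mu]_x F x)%E.
Proof.
move=> s0 b0 FE; have g0 := gauss_ge0 s.
apply: (@le_trans _ _ (\int[mu]_x (b%:E * (gauss s x)%:E))%E).
  rewrite ge0_integralZl_EFin//; last 2 first.
  - by move=> x _; rewrite lee_fin.
  - by apply/measurable_EFinP; exact: measurable_gauss.
  by rewrite integral_gauss// mule1.
apply: ge0_le_integral_sup => x _; last by rewrite -EFinM.
by rewrite -EFinM lee_fin mulr_ge0.
Qed.

(** The area [4 * t] of the square times the lower bound on the complex density there, divided by
    [t]. *)
Definition small_mass (s : R) : R := 4 * expR (- s^-1) ^+ 2 / (pi * s).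

Lemma small_mass_gt0 s : 0 < s -> 0 < small_mass s.
Proof.
by move=> s0; rewrite divr_gt0 ?mulr_gt0 ?exprn_gt0 ?expR_gt0 ?pi_gt0.
Qed.

Lemma integral_small_cgauss_lower s t (Q b : R) (F : R -> R -> \bar R) :
  Q = small_mass s * t -> 0 < s -> 0 < t -> t <= 1 -> 0 <= b ->
  (forall x y, (b * (small t x * small t y) * cgauss_pdf s (x, y))%:E <= F x y)%E ->
  ((b * Q)%:E <= \int[mu]_x \int[mu]_y F x y)%E.
Proof.
move=> -> s0 t0 t1 b0 FE; rewrite /small_mass.
set q := expR (- s^-1) / Num.sqrt (pi * s) * (2 * Num.sqrt t) : R.
have q0 : 0 <= q by rewrite !mulr_ge0 ?invr_ge0 ?sqrtr_ge0// expR_ge0.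
have -> : b * (4 * expR (- s^-1) ^+ 2 / (pi * s) * t) = b * q * q.
  rewrite -[b * q * q]mulrA -expr2 /q !exprMn exprVn !sqr_sqrtr ?(ltW t0)//; last first.
    by rewrite mulr_ge0 ?pi_ge0// ltW.
  by congr (_ * _); ring.
apply: integral_small_gauss_lower => //; first exact: mulr_ge0.
move=> x; have -> : b * q * small t x * gauss s x = b * small t x * gauss s x * q by ring.
apply: integral_small_gauss_lower => //.
  by rewrite !mulr_ge0 ?gauss_ge0// small_ge0.
move=> y; apply: le_trans (FE x y).
by rewrite lee_fin cgauss_pdfE//; lra.
Qed.

Lemma integral_cgauss_lower s (b : R) (F : R -> R -> \bar R) : 0 < s -> 0 <= b ->
  (forall x y, (b * cgauss_pdf s (x, y))%:E <= F x y)%E ->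
  (b%:E <= \int[mu]_x \int[mu]_y F x y)%E.
Proof.
move=> s0 b0 FE; apply: (@integral_gauss_lower s) => // x.
apply: (@integral_gauss_lower s) => [//||y]; first by rewrite mulr_ge0// gauss_ge0.
by apply: le_trans (FE x y); rewrite cgauss_pdfE// mulrA.
Qed.

(** * Probabilities of events in the five gains *)

(** The iterated integral of [outage_prob] before [fine], for an arbitrary event; at the outage
    event the two agree by conversion. *)
Definition gauss_prob5 (s1 s2 s3 s4 s5 : R)
    (E : R * R -> R * R -> R * R -> R * R -> R * R -> bool) : \bar R :=
  (\int[mu]_x1 \int[mu]_y1 \int[mu]_x2 \int[mu]_y2 \int[mu]_x3 \int[mu]_y3
   \int[mu]_x4 \int[mu]_y4 \int[mu]_x5 \int[mu]_y5
     ((if E (x1, y1) (x2, y2) (x3, y3) (x4, y4) (x5, y5) then 1 else 0)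
      * cgauss_pdf s1 (x1, y1) * cgauss_pdf s2 (x2, y2)
      * cgauss_pdf s3 (x3, y3) * cgauss_pdf s4 (x4, y4)
      * cgauss_pdf s5 (x5, y5))%:E)%E.

Lemma small2E t x y : 0 < t ->
  small t x * small t y = (if (x ^+ 2 < t) && (y ^+ 2 < t) then 1 else 0).
Proof.
by move=> t0; rewrite !smallE//; do 2 case: ifP => _; rewrite ?mulr0 ?mulr1.
Qed.

Lemma csqnorm_lt_small t x y : 0 < t -> csqnorm (x, y) < t ->
  small t x * small t y = 1.
Proof.
move=> t0; rewrite /csqnorm/= => xyt; rewrite small2E// ifT//.
have x2 := sqr_ge0 x; have y2 := sqr_ge0 y.
by apply/andP; split; lra.
Qed.

(** The indicator of [E] is at most [S3 * (S1 + S4) * (S2 + S5)] with [Si] the indicator of the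
    square for gain [i], a union bound for each relay; integrating turns each [Si] into [Pi]. *)
Lemma gauss_prob5_upper (s1 s2 s3 s4 s5 t : R)
    (E : R * R -> R * R -> R * R -> R * R -> R * R -> bool) :
  0 < s1 -> 0 < s2 -> 0 < s3 -> 0 < s4 -> 0 < s5 -> 0 < t ->
  (forall z1 z2 z3 z4 z5, E z1 z2 z3 z4 z5 ->
    [/\ csqnorm z3 < t, csqnorm z1 < t \/ csqnorm z4 < t
      & csqnorm z2 < t \/ csqnorm z5 < t]) ->
  (0 <= gauss_prob5 s1 s2 s3 s4 s5 E <=
   (4 * t / (pi * s3) * (4 * t / (pi * s1) + 4 * t / (pi * s4))
                      * (4 * t / (pi * s2) + 4 * t / (pi * s5)))%:E)%E.
Proof.
move=> s1p s2p s3p s4p s5p t0 Esmall; rewrite /gauss_prob5.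
have Pge0 s : 0 < s -> 0 <= 4 * t / (pi * s).
  by move=> ?; rewrite divr_ge0 ?mulr_ge0 ?pi_ge0 ?ltW.
move: (Pge0 _ s1p) (Pge0 _ s2p) (Pge0 _ s3p) (Pge0 _ s4p) (Pge0 _ s5p).
move EP1 : (4 * t / (pi * s1)) => P1; move EP2 : (4 * t / (pi * s2)) => P2.
move EP3 : (4 * t / (pi * s3)) => P3; move EP4 : (4 * t / (pi * s4)) => P4.
move EP5 : (4 * t / (pi * s5)) => P5 P10 P20 P30 P40 P50.
have Tge0 := ltW t0.
have Sge0 x y : 0 <= small t x * small t y by rewrite mulr_ge0// small_ge0.
(* The bound is written as affine in the mass of the outermost gain. Stripping its two integrals
   replaces [P1] by [S1] and brings in the density; the same move repeats for the other gains. *)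
rewrite (_ : P3 * _ * _ = P3 * P4 * (P2 + P5) + P3 * (P2 + P5) * P1); last by ring.
apply: (integral_cgauss_upper s1 t P1 _ _ _ (esym EP1)) => //;
  do ?[exact: mulr_ge0|apply: mulr_ge0|apply: addr_ge0] => //.
move=> x1 y1; have := Sge0 x1 y1; have := cgauss_pdf_ge0 s1 (x1, y1) s1p.
move ES1 : (small t x1 * small t y1) => S1; move: (cgauss_pdf s1 _) => g1 g10 S10.
rewrite (_ : _ * g1 = P3 * (S1 + P4) * P5 * g1 + P3 * (S1 + P4) * g1 * P2); last by ring.
apply: (integral_cgauss_upper s2 t P2 _ _ _ (esym EP2)) => //;
  do ?[exact: mulr_ge0|apply: mulr_ge0|apply: addr_ge0] => //.
move=> x2 y2; have := Sge0 x2 y2; have := cgauss_pdf_ge0 s2 (x2, y2) s2p.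
move ES2 : (small t x2 * small t y2) => S2; move: (cgauss_pdf s2 _) => g2 g20 S20.
rewrite (_ : _ * g2 = 0 + (S1 + P4) * (S2 + P5) * g1 * g2 * P3); last by ring.
apply: (integral_cgauss_upper s3 t P3 _ _ _ (esym EP3)) => //;
  do ?[exact: mulr_ge0|apply: mulr_ge0|apply: addr_ge0] => //.
move=> x3 y3; have := Sge0 x3 y3; have := cgauss_pdf_ge0 s3 (x3, y3) s3p.
move ES3 : (small t x3 * small t y3) => S3; move: (cgauss_pdf s3 _) => g3 g30 S30.
rewrite (_ : _ * g3 = S3 * S1 * (S2 + P5) * g1 * g2 * g3 +
  S3 * (S2 + P5) * g1 * g2 * g3 * P4); last by ring.
apply: (integral_cgauss_upper s4 t P4 _ _ _ (esym EP4)) => //;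
  do ?[exact: mulr_ge0|apply: mulr_ge0|apply: addr_ge0] => //.
move=> x4 y4; have := Sge0 x4 y4; have := cgauss_pdf_ge0 s4 (x4, y4) s4p.
move ES4 : (small t x4 * small t y4) => S4; move: (cgauss_pdf s4 _) => g4 g40 S40.
rewrite (_ : _ * g4 = S3 * (S1 + S4) * S2 * g1 * g2 * g3 * g4 +
  S3 * (S1 + S4) * g1 * g2 * g3 * g4 * P5); last by ring.
apply: (integral_cgauss_upper s5 t P5 _ _ _ (esym EP5)) => //;
  do ?[exact: mulr_ge0|apply: mulr_ge0|apply: addr_ge0] => //.
move=> x5 y5; have := Sge0 x5 y5; have := cgauss_pdf_ge0 s5 (x5, y5) s5p.
move ES5 : (small t x5 * small t y5) => S5; move: (cgauss_pdf s5 _) => g5 g50 S50.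
have G0 : 0 <= g1 * g2 * g3 * g4 * g5 by rewrite !mulr_ge0.
rewrite !lee_fin; apply/andP; split; first by rewrite !mulr_ge0//; case: ifP.
rewrite [leLHS](_ : _ =
  (if E (x1, y1) (x2, y2) (x3, y3) (x4, y4) (x5, y5) then 1 else 0) *
  (g1 * g2 * g3 * g4 * g5)); last by rewrite !mulrA.
rewrite [leRHS](_ : _ =
  S3 * (S1 + S4) * (S2 + S5) * (g1 * g2 * g3 * g4 * g5)); last by ring.
rewrite ler_wpM2r//; case: ifPn => [/Esmall[z3 z14 z25]|_]; last first.
  by rewrite !mulr_ge0// addr_ge0.
have {}z3 : S3 = 1 by rewrite -ES3; exact: csqnorm_lt_small.
have {}z14 : S1 = 1 \/ S4 = 1.
  by case: z14 => z; [left; rewrite -ES1|right; rewrite -ES4]; exact: csqnorm_lt_small.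
have {}z25 : S2 = 1 \/ S5 = 1.
  by case: z25 => z; [left; rewrite -ES2|right; rewrite -ES5]; exact: csqnorm_lt_small.
have {}z14 : 1 <= S1 + S4 by case: z14; lra.
have {}z25 : 1 <= S2 + S5 by case: z25; lra.
rewrite z3; nra.
Qed.

(** The product of three squares lies in [E]; the gains to the destination from the relays are
    unconstrained and integrate to one. *)
Lemma gauss_prob5_lower (s1 s2 s3 s4 s5 t : R)
    (E : R * R -> R * R -> R * R -> R * R -> R * R -> bool) :
  0 < s1 -> 0 < s2 -> 0 < s3 -> 0 < s4 -> 0 < s5 -> 0 < t -> t <= 1 ->
  (forall z1 z2 z3 z4 z5, csqnorm z1 < 2 * t -> csqnorm z2 < 2 * t ->
    csqnorm z3 < 2 * t -> E z1 z2 z3 z4 z5) ->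
  ((small_mass s1 * small_mass s2 * small_mass s3 * t ^+ 3)%:E
    <= gauss_prob5 s1 s2 s3 s4 s5 E)%E.
Proof.
move=> s1p s2p s3p s4p s5p t0 t1 Esmall; rewrite /gauss_prob5.
have Qge0 s : 0 < s -> 0 <= small_mass s * t.
  by move=> s0; rewrite mulr_ge0// ltW// small_mass_gt0.
rewrite [X in X%:E](_ : _ =
  small_mass s2 * t * (small_mass s3 * t) * (small_mass s1 * t)); last by ring.
move: (Qge0 _ s1p) (Qge0 _ s2p) (Qge0 _ s3p).
move EQ1 : (small_mass s1 * t) => Q1; move EQ2 : (small_mass s2 * t) => Q2.
move EQ3 : (small_mass s3 * t) => Q3 Q10 Q20 Q30.
have Sge0 x y : 0 <= small t x * small t y by rewrite mulr_ge0// small_ge0.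
apply: (integral_small_cgauss_lower s1 t Q1 _ _ (esym EQ1)) => //;
  do ?apply: mulr_ge0 => //.
move=> x1 y1; have := Sge0 x1 y1; have := cgauss_pdf_ge0 s1 (x1, y1) s1p.
move ES1 : (small t x1 * small t y1) => S1; move: (cgauss_pdf s1 _) => g1 g10 S10.
rewrite (_ : _ * g1 = Q3 * S1 * g1 * Q2); last by ring.
apply: (integral_small_cgauss_lower s2 t Q2 _ _ (esym EQ2)) => //;
  do ?apply: mulr_ge0 => //.
move=> x2 y2; have := Sge0 x2 y2; have := cgauss_pdf_ge0 s2 (x2, y2) s2p.
move ES2 : (small t x2 * small t y2) => S2; move: (cgauss_pdf s2 _) => g2 g20 S20.
rewrite (_ : _ * g2 = S1 * g1 * S2 * g2 * Q3); last by ring.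
apply: (integral_small_cgauss_lower s3 t Q3 _ _ (esym EQ3)) => //;
  do ?apply: mulr_ge0 => //.
move=> x3 y3; have := Sge0 x3 y3; have := cgauss_pdf_ge0 s3 (x3, y3) s3p.
move ES3 : (small t x3 * small t y3) => S3; move: (cgauss_pdf s3 _) => g3 g30 S30.
apply: (integral_cgauss_lower s4) => //;
  do ?apply: mulr_ge0 => //.
move=> x4 y4; have := cgauss_pdf_ge0 s4 (x4, y4) s4p.
move: (cgauss_pdf s4 _) => g4 g40.
apply: (integral_cgauss_lower s5) => //;
  do ?apply: mulr_ge0 => //.
move=> x5 y5; have := cgauss_pdf_ge0 s5 (x5, y5) s5p.
move: (cgauss_pdf s5 _) => g5 g50; rewrite lee_fin.
rewrite [leLHS](_ : _ = S1 * S2 * S3 * (g1 * g2 * g3 * g4 * g5)); last by ring.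
rewrite [leRHS](_ : _ =
  (if E (x1, y1) (x2, y2) (x3, y3) (x4, y4) (x5, y5) then 1 else 0) *
  (g1 * g2 * g3 * g4 * g5)); last by rewrite !mulrA.
rewrite ler_wpM2r ?mulr_ge0// -ES1 -ES2 -ES3 !small2E//.
have E0 : 0 <= (if E (x1, y1) (x2, y2) (x3, y3) (x4, y4) (x5, y5) then 1 else 0) :> R.
  by case: ifP.
case: ifPn => [/andP[x1t y1t]|_]; last by rewrite !mul0r.
case: ifPn => [/andP[x2t y2t]|_]; last by rewrite mulr0 !mul0r.
case: ifPn => [/andP[x3t y3t]|_]; last by rewrite mulr0.
by rewrite !mulr1 Esmall// /csqnorm/=; lra.
Qed.

(** * Limits of ratios to a logarithm *)

(** Additive constants vanish after division by [ln x]. The lower bound may lose an arbitrary part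
    [e] of the slope, as happens with the fraction [eta] of lost frequencies. *)
Lemma cvg_ln_ratio (u : R -> R) (d : R) :
  (exists K L0, forall x : R, 0 < x -> L0 <= ln x -> u x <= d * ln x + K) ->
  (forall e : R, 0 < e -> exists K L0, forall x : R, 0 < x -> L0 <= ln x ->
     (d - e) * ln x - K <= u x) ->
  (fun x => u x / ln x) @ +oo --> d.
Proof.
move=> [K1 [L1 up]] lo; apply/cvgrPdist_le => e e0.
have e2 : 0 < e / 2 by rewrite divr_gt0.
have [K2 [L2 {}lo]] := lo _ e2.
(* Beyond [expR M] both bounds hold and the constants are absorbed by [e / 2 * ln x]. *)
pose M : R := 1 + `|L1| + `|L2| + (`|K1| + `|K2|) / (e / 2).
have KK0 : 0 <= (`|K1| + `|K2|) / (e / 2) by rewrite divr_ge0 ?addr_ge0// ltW.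
have := (normr_ge0 L1, normr_ge0 L2, ler_norm L1, ler_norm L2) => -[[[n1 n2] n3] n4].
exists (expR M); split; first exact: num_real.
move=> x Mx; have x0 : 0 < x by apply: lt_trans Mx; exact: expR_gt0.
have ML : M < ln x by rewrite -ltr_expR lnK.
have L0 : 0 < ln x by move: ML; rewrite /M; lra.
have KL : `|K1| + `|K2| <= e / 2 * ln x.
  by rewrite mulrC -ler_pdivrMr//; move: ML; rewrite /M; lra.
have {}up : u x <= d * ln x + K1 by apply: up => //; move: ML; rewrite /M; lra.
have {}lo : (d - e / 2) * ln x - K2 <= u x by apply: lo => //; move: ML; rewrite /M; lra.
rewrite distrC ler_distl; apply/andP; split.
  rewrite ler_pdivlMr//; have := ler_norm K2; have := normr_ge0 K1; nra.
rewrite ler_pdivrMr//; have := ler_norm K1; have := normr_ge0 K2; nra.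
Qed.

Lemma ln1D_lt (rho delta kappa x c : R) :
  0 < rho -> 0 < delta -> 0 < kappa -> 0 <= x ->
  kappa * ln (1 + rho * delta * x) < c ->
  x < expR (c / kappa) / (delta * rho).
Proof.
move=> rho0 delta0 kappa0 x0 H.
have y0 : 0 < 1 + rho * delta * x by rewrite ltr_wpDr// !mulr_ge0// ltW.
rewrite ltr_pdivlMr ?mulr_gt0//.
have : 1 + rho * delta * x < expR (c / kappa).
  by rewrite -[ltLHS]lnK// ltr_expR ltr_pdivlMr// mulrC.
lra.
Qed.

(** * The outage event and two-sided bounds on its probability *)

Section Outage.
Context (r Bw tau1 tau2 s2SR1 s2SR2 s2SD s2R1D s2R2D : R).
Context (r0 : 0 < r) (s1p : 0 < s2SR1) (s2p : 0 < s2SR2) (s3p : 0 < s2SD)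
  (s4p : 0 < s2R1D) (s5p : 0 < s2R2D) (Bw0 : 0 < Bw).

Definition outage_event snr z1 z2 z3 z4 z5 : bool :=
  I_TDA r s2SD snr Bw tau1 tau2 z1 z2 z3 z4 z5 < rate r s2SD snr.

Local Notation outage_gauss_prob snr :=
  (gauss_prob5 s2SR1 s2SR2 s2SD s2R1D s2R2D (outage_event snr)).

(** Both terms of the mutual information are nonnegative, so in outage each is below the rate. The
    losses [1 - eta] and [delta] of the relay term are imposed on the direct and source-relay links
    too, so that one threshold [t] serves all gains. *)
Lemma outage_event_small (eta : R) : tau1 != tau2 -> 0 < eta -> eta < 1 ->
  exists2 delta : R, 0 < delta & forall snr z1 z2 z3 z4 z5, 0 < snr ->
  let t := expR (2 * rate r s2SD snr / (1 - eta)) / (delta * rho0 snr) in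
  outage_event snr z1 z2 z3 z4 z5 ->
  [/\ csqnorm z3 < t, csqnorm z1 < t \/ csqnorm z4 < t
    & csqnorm z2 < t \/ csqnorm z5 < t].
Proof.
move=> tau12 eta0 eta1.
have [delta /andP[delta0 delta1] HJ] :=
  Rintegral_relay_power_lower Bw tau1 tau2 eta Bw0 tau12 eta0 eta1.
exists delta => // snr z1 z2 z3 z4 z5 snr0 t.
have rho_gt0 : 0 < rho0 snr by rewrite mulr_gt0// divr_gt0.
have kappa0 : 0 < 1 - eta by rewrite subr_gt0.
have small_of z : (1 - eta) * ln (1 + rho0 snr * delta * csqnorm z) <
    2 * rate r s2SD snr -> csqnorm z < t.
  by apply: ln1D_lt => //; exact: csqnorm_ge0.
have small_of1 z : 2^-1 * ln (1 + rho0 snr * csqnorm z) < rate r s2SD snr ->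
    csqnorm z < t.
  move=> Hz; apply: small_of.
  have p0 : 0 <= rho0 snr * csqnorm z by rewrite mulr_ge0 ?csqnorm_ge0// ltW.
  have q0 : 0 <= rho0 snr * delta * csqnorm z.
    by rewrite !mulr_ge0 ?csqnorm_ge0// ltW.
  have : ln (1 + rho0 snr * delta * csqnorm z) <= ln (1 + rho0 snr * csqnorm z).
    rewrite ler_ln ?posrE ?ltr_wpDr// lerD2l mulrAC ler_piMr//.
  have : 0 <= ln (1 + rho0 snr * delta * csqnorm z) by rewrite ln_ge0// lerDl.
  nra.
rewrite /outage_event /I_TDA /=.
set d1 := decodes _ _ _ z1; set d2 := decodes _ _ _ z2.
(* With undecoding relays given zero gain, the integral bound applies once; it is informative for
   exactly the relays that decode. *)
under eq_Rintegral do rewrite relay_sum_if.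
have [] := HJ (rho0 snr) (if d1 then z4 else 0) (if d2 then z5 else 0) (ltW rho_gt0).
set J := Rintegral _ _ _ => J1 J2 Iout.
have Bw2 : 0 < (2 * Bw)^-1 by rewrite invr_gt0 mulr_gt0.
have J0 : 0 <= J.
  apply: Rintegral_ge0 => f _; rewrite ln_ge0// lerDl mulr_ge0 ?csqnorm_ge0//.
  exact: ltW.
have JI : (2 * Bw)^-1 * J < rate r s2SD snr.
  apply: le_lt_trans Iout; rewrite lerDr mulr_ge0// ln_ge0// lerDl.
  by rewrite mulr_ge0 ?csqnorm_ge0// ltW.
have {}JI (y : R) : Bw * (1 - eta) * y <= J -> (1 - eta) * y < 2 * rate r s2SD snr.
  move=> yJ; have : (2 * Bw)^-1 * (Bw * (1 - eta) * y) < rate r s2SD snr.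
    by apply: le_lt_trans JI; rewrite ler_pM2l.
  have -> : (2 * Bw)^-1 * (Bw * (1 - eta) * y) = (1 - eta) * y / 2.
    by field; rewrite gt_eqF.
  lra.
split.
- apply: small_of1; apply: le_lt_trans Iout; rewrite lerDl.
  by rewrite mulr_ge0// ltW.
- move: J1; rewrite /d1; case: ifPn => [_ /JI/small_of|]; first by right.
  by rewrite /decodes -ltNge => /small_of1; left.
- move: J2; rewrite /d2; case: ifPn => [_ /JI/small_of|]; first by right.
  by rewrite /decodes -ltNge => /small_of1; left.
Qed.

Lemma outage_gauss_prob_upper (eta : R) : tau1 != tau2 -> 0 < eta -> eta < 1 ->
  exists2 C : R, 0 < C & forall snr, 0 < snr ->
  (0 <= outage_gauss_prob snr <=
   (C * (expR (2 * rate r s2SD snr / (1 - eta)) / rho0 snr) ^+ 3)%:E)%E.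
Proof.
move=> tau12 eta0 eta1.
have [delta delta0 small] := outage_event_small eta tau12 eta0 eta1.
have c0 s : 0 < s -> 0 < 4 / (pi * s) :> R.
  by move=> ?; rewrite divr_gt0// mulr_gt0// pi_gt0.
exists (4 / (pi * s2SD) * (4 / (pi * s2SR1) + 4 / (pi * s2R1D)) *
        (4 / (pi * s2SR2) + 4 / (pi * s2R2D)) / delta ^+ 3).
  rewrite divr_gt0 ?exprn_gt0// mulr_gt0//; last by rewrite addr_gt0// c0.
  by rewrite mulr_gt0 ?c0// addr_gt0// c0.
move=> snr snr0; have rho_gt0 : 0 < rho0 snr by rewrite mulr_gt0// divr_gt0.
set x := expR _.
have t0 : 0 < x / (delta * rho0 snr).
  by rewrite divr_gt0 ?mulr_gt0// expR_gt0.
have := gauss_prob5_upper _ _ _ _ _ _ _ s1p s2p s3p s4p s5p t0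
  (fun z1 z2 z3 z4 z5 => small snr z1 z2 z3 z4 z5 snr0).
move=> /andP[-> /le_trans]; apply; rewrite lee_fin le_eqVlt; apply/orP; left.
apply/eqP; have := pi_gt0 R; move: (@pi R) => p p0.
by field; rewrite !gt_eqF.
Qed.

(** Write [N] for the exponential of twice the rate. The factor 4 in [t] makes
    [rho0 snr * csqnorm z < N / 2] on the disc of squared radius [2 * t], and [2 <= N] gives
    [1 + N / 2 <= N], so every such link fails. *)
Lemma outage_gauss_prob_lower : exists2 c : R, 0 < c & forall snr, 0 < snr ->
  let t := expR (2 * rate r s2SD snr) / (4 * rho0 snr) in
  2 <= expR (2 * rate r s2SD snr) -> t <= 1 ->
  ((c * t ^+ 3)%:E <= outage_gauss_prob snr)%E.
Proof.
exists (small_mass s2SR1 * small_mass s2SR2 * small_mass s2SD).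
  apply: mulr_gt0; last exact: small_mass_gt0.
  by apply: mulr_gt0; exact: small_mass_gt0.
move=> snr snr0 t N2 t1.
have rho_gt0 : 0 < rho0 snr by rewrite mulr_gt0// divr_gt0.
have t0 : 0 < t by rewrite divr_gt0 ?mulr_gt0// expR_gt0.
apply: gauss_prob5_lower => // z1 z2 z3 z4 z5 z1t z2t z3t.
have fail z : csqnorm z < 2 * t ->
    2^-1 * ln (1 + rho0 snr * csqnorm z) < rate r s2SD snr.
  move=> zt; have q0 : 0 <= rho0 snr * csqnorm z by rewrite mulr_ge0 ?csqnorm_ge0// ltW.
  have rt : rho0 snr * (2 * t) = expR (2 * rate r s2SD snr) / 2.
    by rewrite /t; field; rewrite gt_eqF.
  have : rho0 snr * csqnorm z < rho0 snr * (2 * t) by rewrite ltr_pM2l.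
  rewrite rt => q1.
  have : ln (1 + rho0 snr * csqnorm z) < 2 * rate r s2SD snr.
    rewrite -ltr_expR lnK ?posrE ?ltr_wpDr//; lra.
  lra.
(* No relay decodes, so the integrand is [ln 1 = 0] and only the failing direct link is left. *)
rewrite /outage_event /I_TDA /decodes !leNgt !fail//= /relay_sum /cadd/=.
under eq_Rintegral do rewrite /csqnorm/= addr0 expr0n/= addr0 mulr0 addr0 ln1.
by rewrite /Rintegral integral0_eq//= mulr0 addr0 fail.
Qed.

(** * Outage exponents on the logarithmic scale *)

(** From [x * s <= 1 + x * s <= x * (1 + s)]; hence the rate is [r * ln snr] up to a bounded
    term. *)
Lemma ln1DM_bounds (s x : R) : 0 < s -> 1 <= x ->
  ln x + ln s <= ln (1 + x * s) <= ln x + ln (1 + s).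
Proof.
move=> s0 x1; have x0 : 0 < x by lra.
have s10 : 0 < 1 + s by lra.
have xs0 : 0 < x * s by rewrite mulr_gt0.
have xs1 : 0 < 1 + x * s by lra.
by rewrite -!lnM ?posrE// !ler_ln ?posrE ?mulr_gt0//; apply/andP; split; nra.
Qed.

Lemma ln_outage_scale (e rho : R) : 0 < rho ->
  ln ((expR e / rho) ^+ 3) = 3 * (e - ln rho).
Proof.
move=> rho_gt0; rewrite lnXn ?divr_gt0 ?expR_gt0// ln_div ?posrE ?expR_gt0//.
by rewrite expRK mulr_natl.
Qed.

Lemma ln_outage_lower : tau1 != tau2 -> r < 2^-1 ->
  exists K L0, forall snr, 0 < snr -> L0 <= ln snr ->
  0 < fine (outage_gauss_prob snr) /\
  - ln (fine (outage_gauss_prob snr)) <= 3 * (1 - 2 * r) * ln snr + K.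
Proof.
move=> tau12 r12.
have h0 : 0 < 2^-1 :> R by rewrite invr_gt0.
have h1 : 2^-1 < 1 :> R by lra.
(* The upper bound serves only to make the probability finite, so any [eta] in the unit interval
   would do. *)
have [C C0 up] := outage_gauss_prob_upper 2^-1 tau12 h0 h1.
have [c c0 lo] := outage_gauss_prob_lower.
pose A := ln s2SD; pose B := ln (1 + s2SD); pose D := ln (4 * (2 / 3)) : R.
exists (- ln c - 6 * r * A + 3 * D).
(* The three thresholds ensure [1 <= snr], [2 <= expR (2 * rate r s2SD snr)] and [t <= 1]; the last
   uses [r < 1 / 2]. *)
exists (Num.max 0 (Num.max (ln 2 / (2 * r) - A) ((2 * r * B - D) / (1 - 2 * r)))).
move=> snr snr0; rewrite !ge_max => /and3P[L0 LA LB].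
have snr1 : 1 <= snr by rewrite -ler_ln ?posrE// ln1.
have /andP[] := ln1DM_bounds s2SD snr s3p snr1; rewrite -/A -/B.
move=> /(ler_wpM2l (ltW r0)) lA /(ler_wpM2l (ltW r0)) lB.
have rho_gt0 : 0 < rho0 snr by rewrite mulr_gt0// divr_gt0.
have r2 : 0 < 1 - 2 * r by lra.
have lnrho : ln (4 * rho0 snr) = D + ln snr.
  by rewrite /rho0 mulrA lnM ?posrE// mulr_gt0// divr_gt0.
have N2 : 2 <= expR (2 * rate r s2SD snr).
  rewrite -[leLHS]lnK ?posrE// ler_expR /rate.
  have : ln 2 <= (ln snr + A) * (2 * r) by rewrite -ler_pdivrMr ?mulr_gt0//; lra.
  lra.
set t := expR (2 * rate r s2SD snr) / (4 * rho0 snr).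
have t0 : 0 < t by rewrite divr_gt0 ?mulr_gt0// expR_gt0.
have lnt : ln (t ^+ 3) = 3 * (2 * rate r s2SD snr - (D + ln snr)).
  by rewrite -lnrho ln_outage_scale// mulr_gt0.
have t1 : t <= 1.
  rewrite -ler_ln ?posrE// ln1 /t ln_div ?posrE ?expR_gt0 ?mulr_gt0//.
  rewrite expRK lnrho /rate.
  have : 2 * r * B - D <= ln snr * (1 - 2 * r) by rewrite -ler_pdivrMr.
  lra.
have {}lo := lo snr snr0 N2 t1; have /andP[P0 Pup] := up snr snr0.
have finP : outage_gauss_prob snr \is a fin_num.
  by rewrite ge0_fin_numE//; apply: le_lt_trans Pup _; rewrite ltry.
have {lo} : c * t ^+ 3 <= fine (outage_gauss_prob snr) by rewrite -lee_fin fineK.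
have ct0 : 0 < c * t ^+ 3 by rewrite mulr_gt0// exprn_gt0.
move=> Plo; have Ppos := lt_le_trans ct0 Plo; split=> //.
move: Plo; rewrite -ler_ln ?posrE// lnM ?posrE ?exprn_gt0// lnt /rate; lra.
Qed.

Lemma ln_outage_upper (e : R) : tau1 != tau2 -> r < 2^-1 -> 0 < e ->
  exists K L0, forall snr, 0 < snr -> L0 <= ln snr ->
  (3 * (1 - 2 * r) - e) * ln snr - K <= - ln (fine (outage_gauss_prob snr)).
Proof.
move=> tau12 r12 e0.
(* The cap at one half gives [(1 - eta)^-1 <= 1 + 2 * eta]; the slope then loses at most
   [12 * r * eta <= 6 * eta], which [e / 12] keeps below [e]. *)
pose eta : R := Num.min 2^-1 (e / 12).
have eta0 : 0 < eta by rewrite lt_min invr_gt0 ltr0n/= divr_gt0.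
have eta12 : eta <= 2^-1 by rewrite ge_min lexx.
have etae : eta <= e / 12 by rewrite ge_min lexx orbT.
have eta1 : eta < 1 by lra.
have [C C0 up] := outage_gauss_prob_upper eta tau12 eta0 eta1.
have [K1 [L1 lo]] := ln_outage_lower tau12 r12.
pose B := ln (1 + s2SD); pose D := ln (2 / 3) : R.
pose k := (1 - eta)^-1.
have k0 : 0 < k by rewrite invr_gt0; lra.
have k1 : k <= 1 + 2 * eta.
  rewrite /k -[leLHS]mul1r ler_pdivrMr; [nra|lra].
exists (ln C + 3 * (2 * r * k * B - D)), (Num.max 0 L1).
move=> snr snr0; rewrite ge_max => /andP[L0 L1L].
(* Positivity, taken from the lower bound on the probability, allows the logarithm of the upper
   bound to be compared. *)
have [Ppos _] := lo snr snr0 L1L; have /andP[P0 Pup] := up snr snr0.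
have snr1 : 1 <= snr by rewrite -ler_ln ?posrE// ln1.
have /andP[_] := ln1DM_bounds s2SD snr s3p snr1; rewrite -/B => lB.
have rho_gt0 : 0 < rho0 snr by rewrite mulr_gt0// divr_gt0.
have lnrho : ln (rho0 snr) = D + ln snr by rewrite lnM ?posrE// divr_gt0.
have finP : outage_gauss_prob snr \is a fin_num.
  by rewrite ge0_fin_numE//; apply: le_lt_trans Pup _; rewrite ltry.
move: Pup; rewrite -[X in (X <= _)%E]fineK// lee_fin.
set y := (_ / rho0 snr) ^+ 3.
have y0 : 0 < y by rewrite exprn_gt0// divr_gt0// expR_gt0.
have Cy0 : 0 < C * y by exact: mulr_gt0.
rewrite -ler_ln ?posrE// lnM ?posrE// /y ln_outage_scale// lnrho.
rewrite -/k /rate => Pup.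
have : 2 * (r * ln (1 + snr * s2SD)) * k <= 2 * r * k * (ln snr + B).
  have -> : 2 * (r * ln (1 + snr * s2SD)) * k = 2 * r * k * ln (1 + snr * s2SD) by ring.
  by rewrite ler_wpM2l// !mulr_ge0// ltW.
have : 6 * r * k * ln snr <= (6 * r + e) * ln snr.
  rewrite ler_wpM2r//; have := ler_wpM2l (ltW r0) k1.
  by have : r * eta <= 2^-1 * eta by [rewrite ler_wpM2r// ltW]; lra.
lra.
Qed.

End Outage.

End DelayDiversity.

Theorem theorem3 (R : realType) (r Bw tau1 tau2 : R)
  (s2SR1 s2SR2 s2SD s2R1D s2R2D : R) :
  0 < r -> r < 2^-1 ->
  0 < s2SR1 -> 0 < s2SR2 -> 0 < s2SD -> 0 < s2R1D -> 0 < s2R2D ->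
  0 < Bw -> 2 <= `|tau2 - tau1| * Bw ->
  (fun snr : R =>
     - ln (outage_prob r Bw tau1 tau2 s2SR1 s2SR2 s2SD s2R1D s2R2D snr)
       / ln snr)
    @ +oo --> 3 * (1 - 2 * r).
Proof.
move=> r0 r12 s1p s2p s3p s4p s5p Bw0 TB.
have tau12 : tau1 != tau2.
  by apply/eqP => tau12; move: TB; rewrite tau12 subrr normr0 mul0r lern0.
apply: cvg_ln_ratio.
  have [K [L0 lo]] := ln_outage_lower r Bw tau1 tau2 _ _ _ _ _
    r0 s1p s2p s3p s4p s5p Bw0 tau12 r12.
  by exists K, L0 => snr snr0 /(lo _ snr0)[].
move=> e e0.
exact: (ln_outage_upper r Bw tau1 tau2 _ _ _ _ _
  r0 s1p s2p s3p s4p s5p Bw0 e tau12 r12 e0).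
Qed.
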